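(* For any positive integers $k$ and $d$, and any partition $\mu=(\mu_1,\dotsc,\mu_m)$ of $k$, $$\lim_{n\to\infty}\frac{\#\{\lambda\vdash n \mid \chi^\lambda_\mu \text{ is divisible by } d\}}{p(n)}=1.$$
   Context: Here $\lambda\vdash n$ means that $\lambda$ is a partition of the integer $n$, and $p(n)$ denotes the number of partitions of $n$. Complex irreducible characters of the symmetric group $S_n$ are indexed by partitions of $n$ in the standard way. For a partition $\mu=(\mu_1,\dotsc,\mu_m)$ of $k$ and a partition $\lambda$ of an integer $n\geq k$, $\chi^\lambda_\mu$ denotes the value of the irreducible character of $S_n$ corresponding to $\lambda$ at a permutation with cycle type $(\mu_1,\dotsc,\mu_m,1^{n-k})$, i.e. with cycles of lengths $\mu_1,\dotsc,\mu_m$ together with $n-k$ additional fixed points. These values are integers, and divisibility is in $\mathbb{Z}$ (in particular $0$ is divisible by $d$). The limit is taken over integers $n\geq k$. *)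

(* Defs.v *)
From HB Require Import structures.
From mathcomp Require Import all_boot all_order all_algebra all_fingroup.
From mathcomp Require Import all_field all_character.

Set Implicit Arguments.
Unset Strict Implicit.
Unset Printing Implicit Defensive.

Import GroupScope GRing.Theory.

Definition is_partition (n : nat) (la : seq nat) : bool :=
  [&& sorted geq la, all (fun x => 0 < x)%N la & sumn la == n].

(* A partition of n has at most n parts, each at most n, so the finite type
   n.-bseq 'I_n.+1 (sequences of length at most n over {0, ..., n}) contains
   all of them. *)
Definition parts (n : nat) (la : n.-bseq 'I_n.+1) : seq nat :=
  [seq val i | i <- la].

Definition partitions (n : nat) : {set n.-bseq 'I_n.+1} :=
  [set la | is_partition n (parts la)].

Lemma partitions_surj (n : nat) (la : seq nat) :
  is_partition n la -> exists2 nu, nu \in partitions n & parts nu = la.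
Proof.
case/and3P=> sla pla /eqP nla.
have le_size : (size la <= n)%N.
  rewrite -nla; elim: la pla {sla nla} => //= x s IHs /andP[x0 /IHs].
  by move=> le_s; rewrite -add1n leq_add.
have le_parts : all (fun x => x < n.+1)%N la.
  rewrite -nla; apply/allP => x; elim: la {sla pla nla le_size} => //= y s IHs.
  rewrite inE ltnS => /predU1P[-> | /IHs]; first exact: leq_addr.
  by rewrite ltnS => le_x; apply: leq_trans le_x (leq_addl _ _).
have mK : [seq val i | i <- [seq inord x : 'I_n.+1 | x <- la]] = la.
  rewrite -map_comp -[RHS]map_id; apply/eq_in_map => x lax /=.
  by rewrite inordK // (allP le_parts).
have sz : (size [seq inord x : 'I_n.+1 | x <- la] <= n)%N by rewrite size_map.
exists (Bseq sz); last exact: mK.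
by rewrite inE /is_partition /parts /= mK sla pla nla eqxx.
Qed.

(* The row-reading tableau of shape la: 0, 1, 2, ... are written in the Young
   diagram of la row after row, so that i sits in row [reshape_index la i] and
   column [reshape_offset la i]. *)
Definition row_stabilizer (n : nat) (la : seq nat) : {set 'S_n} :=
  [set s : 'S_n | [forall i : 'I_n,
    reshape_index la (s i) == reshape_index la i]].

Definition col_stabilizer (n : nat) (la : seq nat) : {set 'S_n} :=
  [set s : 'S_n | [forall i : 'I_n,
    reshape_offset la (s i) == reshape_offset la i]].

(* The Young symmetrizer a_la b_la = sum_(g, h) sgn(h) g h of C[S_n], g and h
   ranging over the row and column stabilizers, in coordinates with respect to
   the basis S_n of C[S_n]; algC stands for C, which is harmless as all complex
   representations of a finite group are defined over algC. *)
Definition young_symmetrizer (n : nat) (la : seq nat) :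
    'rV[algC]_#|[set: 'S_n]%G| :=
  (\sum_(g in row_stabilizer n la) \sum_(h in col_stabilizer n la)
     (-1) ^+ odd_perm h *: delta_mx 0 (gring_index [set: 'S_n]%G (g * h)%g))%R.

(* chi^la, the character of the Specht module generated by the Young symmetrizer
   in the regular module.  Representations act on row vectors, from the right:
   this is the right ideal c C[S_n], with c = a_la b_la.  The one-row partition
   yields the trivial character, the one-column partition the sign. *)
Definition specht_character (n : nat) (la : seq nat) : 'CF([set: 'S_n]%G) :=
  cfRepr (submod_repr (cyclic_mx_module (regular_repr algC [set: 'S_n]%G)
                                        (young_symmetrizer n la))).

Definition cycle_lengths (n : nat) (s : 'S_n) : seq nat :=
  [seq #|C| | C : {set 'I_n} in porbits s].

Definition has_cycle_type (n : nat) (sh : seq nat) (s : 'S_n) : bool :=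
  perm_eq (cycle_lengths s) sh.

(* A permutation with cycle type (mu, 1^(n - |mu|)); the default value is
   irrelevant when |mu| <= n, see [cycle_permP]. *)
Definition cycle_perm (n : nat) (mu : seq nat) : 'S_n :=
  odflt 1 [pick s : 'S_n | has_cycle_type (mu ++ nseq (n - sumn mu) 1%N) s].

(* chi^la_mu for a partition la of n and a partition mu of some k <= n *)
Definition char_value (n : nat) (la mu : seq nat) : algC :=
  specht_character n la (cycle_perm n mu).

Lemma has_cycle_type_exists (n : nat) (sh : seq nat) :
  all (fun x => 0 < x)%N sh -> sumn sh = n ->
  exists s : 'S_n, has_cycle_type sh s.
Proof.
move=> sh_gt0 sumsh.
pose row (i : 'I_n) := reshape_index sh i.
pose block r := [set i : 'I_n | row i == r].
pose f i := next (enum (block (row i))) i.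
have mem_blk i : i \in enum (block (row i)) by rewrite mem_enum inE.
have row_f i : row (f i) = row i.
  have : f i \in enum (block (row i)) by rewrite /f mem_next.
  by rewrite mem_enum inE => /eqP.
have f_inj : injective f.
  move=> i j eq_f; have eq_r : row i = row j by rewrite -row_f eq_f row_f.
  move: eq_f; rewrite /f eq_r; apply: (can_inj (prev_next _)).
  exact: enum_uniq.
pose s := perm f_inj.
have porbitE i : porbit s i = block (row i).
  apply/setP => j; apply/porbitP/idP => [[m ->]|].
    rewrite inE; elim: m => [|m IHm]; first by rewrite expg0 perm1.
    by rewrite expgSr permM permE row_f.
  rewrite -mem_enum => jB.
  have fc : fcycle s (enum (block (row i))).
    have /(_ (enum_uniq _)) := @cycle_next _ (enum (block (row i))).
    rewrite (@eq_in_cycle _ (mem (enum (block (row i)))) _ (frel s)) //.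
      move=> x y; rewrite !mem_enum inE => /eqP rx _.
      by rewrite /= permE /f rx.
  have := fconnect_cycle fc (mem_blk i) j; rewrite jB => /iter_findex jE.
  by exists (findex s i j); rewrite permX jE.
have card_block r : (r < size sh)%N -> #|block r| = nth 0%N sh r.
  move=> ltr.
  have lt_n c : (c < nth 0 sh r)%N -> (flatten_index sh r c < n)%N.
    by move=> ltc; rewrite -sumsh flatten_indexP.
  pose g (c : 'I_(nth 0%N sh r)) : 'I_n := Ordinal (lt_n c (ltn_ord c)).
  have g_inj : injective g.
    move=> c c' /(congr1 val) /= /(congr1 (reshape_offset sh)).
    by rewrite !flatten_indexKr // => /val_inj.
  rewrite -[RHS]card_ord -(card_imset _ g_inj); congr #|pred_of_set _|.
  apply/setP => i; rewrite inE; apply/eqP/imsetP => [ri|[c _ ->]].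
    have ltc : (reshape_offset sh i < nth 0 sh r)%N.
      by rewrite -ri reshape_offsetP // sumsh.
    exists (Ordinal ltc) => //; apply/val_inj => /=.
    by rewrite -[LHS](reshape_indexK sh) -/(row i) ri.
  by rewrite /row /= flatten_indexKl.
have block_n0 r : (r < size sh)%N -> block r != set0.
  by move=> ltr; rewrite -card_gt0 card_block // (allP sh_gt0) ?mem_nth.
have perm_blocks : perm_eq (enum (porbits s)) [seq block r | r <- iota 0 (size sh)].
  apply: uniq_perm; first exact: enum_uniq.
    rewrite map_inj_in_uniq ?iota_uniq // => r r'.
    rewrite !mem_iota !add0n /= => ltr _ eq_b.
    have /set0Pn[x xr] := block_n0 _ ltr.
    by move: (xr); rewrite eq_b; move: xr; rewrite !inE => /eqP-> /eqP.
  move=> B; rewrite mem_enum; apply/imsetP/mapP => [[i _ ->] | [r]].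
    exists (row i); last exact: porbitE.
    by rewrite mem_iota add0n /= reshape_indexP // sumsh.
  rewrite mem_iota add0n /= => /block_n0/set0Pn[x xr] ->; exists x => //.
  by rewrite porbitE; move: xr; rewrite inE => /eqP->.
exists s; rewrite /has_cycle_type /cycle_lengths /image_mem.
apply: (perm_trans (perm_map _ perm_blocks)).
rewrite -map_comp (_ : map _ _ = sh) //.
rewrite -[RHS](mkseq_nth 0%N); apply/eq_in_map => r.
by rewrite mem_iota add0n /=; apply: card_block.
Qed.

Lemma cycle_permP (n k : nat) (mu : seq nat) :
  is_partition k mu -> (k <= n)%N ->
  has_cycle_type (mu ++ nseq (n - k) 1%N) (cycle_perm n mu).
Proof.
case/and3P=> _ mu_gt0 /eqP <- le_n; rewrite /cycle_perm.
case: pickP => //= no_s.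
have [||s] := @has_cycle_type_exists n (mu ++ nseq (n - sumn mu) 1%N).
- by rewrite all_cat mu_gt0 all_nseq orbT.
- by rewrite sumn_cat sumn_nseq mul1n subnKC.
by rewrite no_s.
Qed.

(* Main.v *)
Require Import Defs.
From HB Require Import structures.
From mathcomp Require Import all_boot all_order all_algebra all_fingroup.
From mathcomp Require Import all_field all_solvable all_character.
From mathcomp Require Import zify ring.

(** For a prime power [p^e] exactly dividing [d], let [p^N] be the largest power
    of [p] that is at most [n - k].  A permutation [g] of type [(mu, 1^(n-k))]
    commutes with a cycle [c] of length [p^N] moving only fixed points of [g].
    If a character [chi] of [S_n] vanishes on every permutation having a cycle of
    length [p^(N-v)] for some [v < e], then [chi] vanishes on [<g, c>] outside
    [<g, c^(p^e)>]; as linear characters extend, the multiplicities of the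
    restriction of [chi] to the smaller group are divisible by the index [p^e],
    hence so is [chi g].

    Few irreducible characters fail to vanish on some permutation with a cycle of
    length [t].  Fix a [t]-cycle [c], and let [H] be the pointwise stabilizer of its
    support.  The mean square of [chi] over the coset [H c] is an algebraic
    integer and rational, so it is at least 1 when [chi] does not vanish on
    [H c]; by column orthogonality these mean squares add up to the mean over [h]
    in [H] of [#|'C[h c]|], and [#|'C[h c]| <= n * #|'C_H[h]|].  So at most
    [n * p(n - t)] irreducible characters are bad for [t].

    Here every [t = p^(N-v)] is at least a constant times [n], and counting the
    pairs (partition of [n], part) gives [m^2 p(n - m) <= 2 n p(n)], whence
    [n p(n - t) / p(n) = O(1/n)].  The bad partitions inject into the bad
    irreducible characters because Specht characters of distinct shapes have no
    common constituent. *)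

Set Implicit Arguments.
Unset Strict Implicit.
Unset Printing Implicit Defensive.

(** * Rationality and divisibility of character values *)

Section Characters.

Import GroupScope GRing.Theory Num.Theory.
Local Open Scope ring_scope.

(** On the cyclic group of [g] the character is a sum of linear characters, whose values are powers
    of one primitive root of unity [z]; [u] raises [z] to a power coprime to the order. *)
Lemma char_aut_exp (gT : finGroupType) (G : {group gT}) (chi : 'CF(G)) g
    (u : {rmorphism algC -> algC}) :
    chi \is a character -> g \in G ->
  exists2 k, coprime k #[g] & u (chi g) = chi (g ^+ k)%g.
Proof.
move=> Nchi Gg; have [z prim_z] := C_prim_root_exists (order_gt0 g).
have [k co_k Dk] := aut_prim_rootP u prim_z; exists k => //.
have sgG: <[g]>%g \subset G by rewrite cycle_subG.
rewrite -!(cfResE chi sgG) ?mem_cycle ?cycle_id //.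
rewrite ['Res _]cfun_sum_constt !sum_cfunE rmorph_sum /=.
apply: eq_bigr => i _; rewrite !cfunE rmorphM /=.
have Lchi: 'chi_i \is a linear_char by rewrite irr_cyclic_lin ?cycle_cyclic.
rewrite lin_charX ?cycle_id //; congr (_ * _).
  have /natrP[m ->] : '['Res[<[g]>%g] chi, 'chi_i] \in Num.nat.
    by rewrite Cnat_cfdot_char_irr ?cfRes_char.
  exact: rmorph_nat.
have /(prim_rootP prim_z)[m ->] : 'chi_i g ^+ #[g]%g = 1.
  by rewrite -lin_charX ?cycle_id // expg_order lin_char1.
by rewrite rmorphXn /= Dk exprAC.
Qed.

Lemma char_Crat (gT : finGroupType) (G : {group gT}) (chi : 'CF(G)) g :
    chi \is a character -> g \in G ->
    (forall k, coprime k #[g]%g -> (g ^+ k)%g \in g ^: G) ->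
  chi g \in Crat.
Proof.
move=> Nchi Gg conj_g.
have [Qn galQ [QnC nuP [w [_ _] QnG]]] := group_num_field_exists <[g]>%G.
have [a Da] := QnG _ G _ Nchi g (dvdnn _).
suffices /vlineP[c Dc] : a \in 1%VS.
  by rewrite -Da Dc alg_num_field fmorph_rat rpred_rat.
(* The value is rational once all Galois automorphisms fix it, and each of them merely replaces [g]
   by a conjugate power. *)
have /= <- := galois_fixedField galQ.
apply/fixedFieldP; first exact: memvf.
move=> nu Gnu; apply: (fmorph_inj QnC).
have [f Df] := nuP nu; rewrite Df Da.
have [k co_k ->] := char_aut_exp f Nchi Gg.
by have /imsetP[y Gy ->] := conj_g k co_k; rewrite cfunJ.
Qed.

(** Take a constituent of the character induced to [G]: by Frobenius reciprocity its restriction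
    contains ['chi_i], and equals it because it is linear. *)
Lemma lin_char_ext (gT : finGroupType) (G H : {group gT}) (i : Iirr H) :
  H \subset G -> abelian G -> exists j, 'Res[H] 'chi[G]_j = 'chi_i.
Proof.
move=> sHG cGG.
have [j] := neq0_has_constt (Ind_irr_neq0 i sHG).
rewrite constt_Ind_Res => ij; exists j.
have linj : 'Res[H] 'chi[G]_j \is a linear_char.
  by rewrite cfRes_lin_char //; apply/char_abelianP.
have /irrP[m Dm] := lin_char_irr linj.
by move: ij; rewrite Dm constt_irr inE => /eqP->.
Qed.

(* Every irreducible character of K extends to G, so the multiplicities of the
   restriction of chi to K are #|G : K| times multiplicities of chi. *)
Lemma dvdA_char_support (gT : finGroupType) (G K : {group gT})
    (chi : 'CF(G)) x :
    K \subset G -> abelian G -> chi \is a character ->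
    chi \in 'CF(G, K) -> x \in K ->
  (#|G : K|%g%:R %| chi x)%A.
Proof.
move=> sKG cGG Nchi Kchi Kx; rewrite -(cfResE chi sKG Kx).
rewrite ['Res _]cfun_sum_cfdot sum_cfunE rpred_sum // => i _; rewrite cfunE.
have [j <-] := lin_char_ext i sKG cGG.
have -> : '['Res[K] chi, 'Res[K] 'chi_j] = #|G : K|%g%:R * '[chi, 'chi_j].
  rewrite (cfdotEl _ Kchi) -(Lagrange sKG) mulnC natrM invfM -mulrA.
  rewrite mulVKf ?neq0CiG //; congr (_ * _).
  by apply: eq_bigr => y Ky; rewrite !cfResE.
rewrite -mulrA -eqAmod0 eqAmodMr0 // rpredM ?Aint_char //.
  by rewrite Aint_Cnat // Cnat_cfdot_char_irr.
by rewrite cfRes_char ?irr_char.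
Qed.

End Characters.

(** * Conjugacy in pointwise stabilizers *)

Section Permutations.

Import GroupScope.
Local Open Scope nat_scope.

(** The counting arguments below come with a relation rather than a map; choosing a related [y] for
    each [x] gives the injection. *)
Lemma leq_card_rel (T1 T2 : finType) (A : {set T1}) (B : {set T2})
    (r : T1 -> T2 -> bool) :
    {in A, forall x, exists2 y, y \in B & r x y} ->
    {in A &, forall x x' y, r x y -> r x' y -> x = x'} ->
  #|A| <= #|B|.
Proof.
move=> ex_r inj_r; pose f x := [pick y in B | r x y].
have fP x : x \in A -> exists y, [/\ f x = Some y, y \in B & r x y].
  move=> Ax; rewrite /f; case: pickP => [y /andP[]|no_y]; first by exists y.
  by have [y By rxy] := ex_r x Ax; have := no_y y; rewrite By rxy.
have f_inj : {in A &, injective f}.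
  move=> x x' Ax Ax' eq_f.
  have [[y [fy _ ry]] [y' [fy' _ ry']]] := (fP x Ax, fP x' Ax').
  move: eq_f; rewrite fy fy' => -[eq_y].
  by apply: (inj_r _ _ Ax Ax' y); rewrite // eq_y.
have Some_inj : injective (@Some T2) by move=> ? ? [].
rewrite -(card_in_imset f_inj) -(card_imset B Some_inj).
apply/subset_leq_card/subsetP => _ /imsetP[x Ax ->].
by have [y [-> By _]] := fP x Ax; apply: imset_f.
Qed.

Variable T : finType.
Implicit Types (s : {perm T}) (C : {set T}).

Lemma perm_map_seq (e1 e2 : seq T) :
  uniq e1 -> uniq e2 -> e1 =i T -> e2 =i T ->
  exists s : {perm T}, map s e1 = e2.
Proof.
move=> U1 U2 e1T e2T.
have eq_sz : size e1 = size e2.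
  by apply/eqP; rewrite eq_sym -(uniq_size_uniq U1) // => x; rewrite e1T e2T.
pose f x := nth x e2 (index x e1).
have lt_f x : index x e1 < size e2 by rewrite -eq_sz index_mem e1T.
have f_inj : injective f.
  move=> x y; rewrite /f (set_nth_default y) // => /eqP.
  rewrite nth_uniq // => /eqP eq_i.
  by rewrite -(nth_index y (_ : x \in e1)) ?e1T // eq_i nth_index ?e1T.
have [x0 _|noT] := pickP T; last first.
  exists 1%g; case: (e1) eq_sz => [|x e]; first by case: (e2).
  by have := noT x.
exists (perm f_inj).
apply: (@eq_from_nth _ x0) => [|i]; rewrite size_map // => lt_i.
rewrite (nth_map x0) // permE /f index_uniq //.
by apply: set_nth_default; rewrite -eq_sz.
Qed.

(** The blocks list the cycles of [s1] and [s2]; matching them entry by entry carries successors to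
    successors, which is conjugation. *)
Lemma perm_conj_blocks s1 s2 (L1 L2 : seq (seq T)) :
    map size L1 = map size L2 ->
    uniq (flatten L1) -> uniq (flatten L2) ->
    flatten L1 =i T -> flatten L2 =i T ->
    all (fcycle s1) L1 -> all (fcycle s2) L2 ->
  exists2 s : {perm T}, map (map s) L1 = L2 & (s1 ^ s)%g = s2.
Proof.
move=> eq_sz U1 U2 L1T L2T cyc1 cyc2.
have [s Ds] := perm_map_seq U1 U2 L1T L2T.
have sL : map (map s) L1 = L2.
  rewrite -[L1]flattenK -[L2]flattenK map_reshape Ds; congr (reshape _ _).
  exact: eq_sz.
exists s => //; apply/perm.permP => y; rewrite -[y](permKV s) permJ.
set x := s^-1 y; have /flattenP[b L1b bx] : x \in flatten L1 by rewrite L1T.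
have /eqP -> := next_cycle (allP cyc1 _ L1b) bx.
have Lsb : map s b \in L2 by rewrite -sL map_f.
rewrite -(next_map (@perm_inj _ s)).
  have /eqP -> // := next_cycle (allP cyc2 _ Lsb) (map_f s bx).
move: U1; elim: (L1) L1b => //= b' L IH; rewrite inE cat_uniq.
by case/predU1P=> [<- /and3P[]|/IH IHL /and3P[_ _ /IHL]].
Qed.

Definition pfixer C : {group {perm T}} := 'C(C | 'P)%G.

Lemma pfixerP C s : reflect {in C, forall x, s x = x} (s \in pfixer C).
Proof.
by apply: (iffP (astabP (to := 'P))) => fixC x Cx; have := fixC x Cx.
Qed.

Definition outer_porbits C s := [set porbit s x | x in ~: C].

Definition outer_shape C s : seq nat :=
  sort geq [seq #|pred_of_set Q| | Q <- enum (outer_porbits C s)].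

Lemma sorted_outer_porbits C s :
  [seq #|pred_of_set Q| | Q <- sort (relpre (fun Q : {set T} => #|Q|) geq)
                          (enum (outer_porbits C s))] = outer_shape C s.
Proof. by rewrite /outer_shape sort_map. Qed.

Lemma outer_shape_partition C s :
  s \in pfixer C -> is_partition #|~: C| (outer_shape C s).
Proof.
move=> /pfixerP fixC; apply/and3P; split.
- by apply: sort_sorted => m n; apply: leq_total.
- rewrite all_sort all_map; apply/allP => Q; rewrite mem_enum.
  by case/imsetP=> x _ -> /=; rewrite lt0n card_porbit_neq0.
rewrite (perm_sumn (permEl (perm_sort _ _))).
rewrite sumnE big_map big_enum /= -(sum1_card (mem (~: C))) /=.
rewrite (partition_big_imset (porbit s)) /=; apply/eqP/eq_bigr => Q.
case/imsetP=> x; rewrite inE => C'x ->; rewrite -sum1_card; apply: eq_bigl => y.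
rewrite eq_porbit_mem inE andb_idl // => /porbitP[i ->].
(* An orbit starting outside [C] never enters it: [s] fixes [C] pointwise, so injectivity pulls
   membership in [C] back to [x]. *)
apply: contra C'x => Cxi; have := Cxi.
suffices <- : (s ^+ i) x = x by [].
elim: i Cxi => [|i IHi]; first by rewrite expg0 perm1.
rewrite expgSr permM => Csx.
have eq_si : s (s ((s ^+ i) x)) = s ((s ^+ i) x) by apply: fixC.
by move/perm_inj: eq_si => /[dup] eq_si ->; apply: IHi; rewrite -eq_si.
Qed.

Definition cycle_block s (Q : {set T}) :=
  if [pick x in Q] is Some x then traject s x #|Q| else [::].

Lemma cycle_blockP s x :
  let b := cycle_block s (porbit s x) in
  [/\ size b = #|porbit s x|, b =i porbit s x & fcycle s b].
Proof.
rewrite /cycle_block; case: pickP => [y|/(_ x)]; last by rewrite porbit_id.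
rewrite -eq_porbit_mem => /eqP <-; rewrite size_traject.
split=> // [z|]; first by rewrite porbit_traject.
case Dn: #|porbit s y| => [//|n] /=.
have Dy : iter n s (s y) = y by rewrite -iterSr -Dn iter_porbit.
suff -> : rcons (traject s (s y) n) y = traject s (s y) n.+1.
  exact: fpath_traject.
by rewrite trajectSr Dy.
Qed.

(** The points of [C] come first, in an order independent of [s], so that a permutation matching the
    blocks of two elements fixes [C] pointwise. Sorting the other cycles by length aligns equal
    shapes. *)
Definition pfixer_blocks C s : seq (seq T) :=
  [seq [:: x] | x <- enum C] ++
  [seq cycle_block s Q | Q <- sort (relpre (fun Q : {set T} => #|Q|) geq)
                                (enum (outer_porbits C s))].

Lemma pfixer_blocksP C s : s \in pfixer C ->
  [/\ map size (pfixer_blocks C s) = nseq #|C| 1 ++ outer_shape C s,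
      uniq (flatten (pfixer_blocks C s)), flatten (pfixer_blocks C s) =i T
    & all (fcycle s) (pfixer_blocks C s)].
Proof.
move=> fixC; have := fixC => /pfixerP fixCE.
have sz : map size (pfixer_blocks C s) = nseq #|C| 1 ++ outer_shape C s.
  rewrite map_cat -map_comp; congr (_ ++ _).
    by rewrite cardE; elim: (enum C) => //= x e ->.
  rewrite -sorted_outer_porbits -map_comp; apply/eq_in_map => Q.
  rewrite mem_sort mem_enum => /imsetP[x _ ->] /=.
  by have [-> _ _] := cycle_blockP s x.
have memT : flatten (pfixer_blocks C s) =i T.
  move=> x; rewrite inE flatten_cat mem_cat.
  have [Cx|C'x] := boolP (x \in C).
    by apply/orP; left; apply/flatten_mapP; exists x; rewrite ?mem_enum ?inE.
  apply/orP; right; apply/flatten_mapP; exists (porbit s x).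
    by rewrite mem_sort mem_enum imset_f ?inE.
  by have [_ -> _] := cycle_blockP s x; apply: porbit_id.
split=> //.
  apply: (leq_size_uniq (enum_uniq T)) => [x|]; first by rewrite memT.
  rewrite size_flatten /shape sz sumn_cat sumn_nseq mul1n.
  have /and3P[_ _ /eqP->] := outer_shape_partition fixC.
  by rewrite cardsC -cardT.
rewrite all_cat !all_map; apply/andP; split; [apply/allP=> x | apply/allP=> Q].
  by rewrite mem_enum => Cx /=; rewrite fixCE ?eqxx.
rewrite mem_sort mem_enum => /imsetP[x _ ->] /=.
by have [_ _ ->] := cycle_blockP s x.
Qed.

Lemma pfixer_conj C s1 s2 :
    s1 \in pfixer C -> s2 \in pfixer C -> outer_shape C s1 = outer_shape C s2 ->
  s2 \in s1 ^: pfixer C.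
Proof.
move=> fix1 fix2 eq_sh.
have [sz1 U1 T1 cyc1] := pfixer_blocksP fix1.
have [sz2 U2 T2 cyc2] := pfixer_blocksP fix2.
have [|s Ds <-] := perm_conj_blocks _ U1 U2 T1 T2 cyc1 cyc2.
  by rewrite sz1 sz2 eq_sh.
apply/imset_f/pfixerP => x Cx.
move: Ds; rewrite /pfixer_blocks map_cat -map_comp => /(congr1 (take #|C|)).
rewrite !take_size_cat ?size_map -?cardE // => /eq_in_map/(_ x).
by rewrite mem_enum => /(_ Cx) /= [].
Qed.

Lemma card_classes_pfixer C :
  #|classes (pfixer C)| <= #|partitions #|~: C| |.
Proof.
apply: (@leq_card_rel _ _ _ _ (fun A nu => outer_shape C (repr A) == parts nu)).
  move=> A /repr_classesP[fixA _].
  have [nu nu_part Dnu] := partitions_surj (outer_shape_partition fixA).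
  by exists nu => //; rewrite Dnu.
move=> A B /repr_classesP[fixA defA] /repr_classesP[fixB defB] nu.
move=> /eqP shA /eqP shB; rewrite defA defB; apply/class_eqP.
by apply: pfixer_conj; rewrite ?shA.
Qed.

(** A coprime power generates the same cyclic group, hence has the same orbits; [pfixer_conj] with
    empty [C] concludes. *)
Lemma perm_exp_conj s k : coprime k #[s]%g -> (s ^+ k)%g \in s ^: [set: {perm T}].
Proof.
move=> co_k; have fix0 u : u \in pfixer set0 by apply/pfixerP => x; rewrite inE.
suffices /imsetP[u _ ->] : (s ^+ k)%g \in s ^: pfixer set0 by apply: imset_f.
apply: pfixer_conj => //.
have eq_porb : porbit (s ^+ k) =1 porbit s.
  rewrite coprime_sym -generator_coprime in co_k.
  by move=> x; rewrite porbit.unlock (eqP co_k).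
by rewrite /outer_shape /outer_porbits (eq_imset _ eq_porb).
Qed.

Lemma char_Sym_Crat (chi : 'CF([set: {perm T}]%G)) s :
  chi \is a character -> chi s \in Crat.
Proof.
move=> Nchi; apply: char_Crat Nchi (in_setT s) _ => k; exact: perm_exp_conj.
Qed.

End Permutations.

(** * Irreducible characters not vanishing on a cycle *)

Section CycleVanishing.

Import GroupScope Order.TTheory GRing.Theory Num.Theory.
Local Open Scope ring_scope.

(** Sum the squared modulus of ['chi_i h] over [i] and [h]: the second orthogonality relation
    evaluates the sum over [i], the first the sum over [h]. *)
Lemma sum_card_cent1 (gT : finGroupType) (H : {group gT}) :
  (\sum_(h in H) #|'C_H[h]| = #|H| * #|classes H|)%N.
Proof.
apply/eqP; rewrite -(eqr_nat algC) natr_sum natrM -NirrE; apply/eqP.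
transitivity (\sum_(h in H) \sum_i 'chi[H]_i h * ('chi_i h)^*).
  by apply: eq_bigr => h Hh; rewrite second_orthogonality_relation // class_refl.
have -> : (Nirr H)%:R = \sum_(i : Iirr H) 1 :> algC by rewrite sumr_const card_ord.
rewrite exchange_big mulr_sumr /=.
apply: eq_bigr => i _; rewrite mulr1 -[LHS](mulVKf (neq0CG H)).
by rewrite -cfdotE cfnorm_irr mulr1.
Qed.

Variable T : finType.
Implicit Types (s h y : {perm T}) (C : {set T}).

Let G := [set: {perm T}]%G.

Lemma sum_norm_irr_perm s :
  \sum_i `|'chi[G]_i s| ^+ 2 = #|'C[s]%g|%:R.
Proof.
have := second_orthogonality_relation s (in_setT s : s \in G).
rewrite class_refl mulr1n setTI => <-.
by apply: eq_bigr => i _; rewrite normCK.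
Qed.

Section FixedCycle.

Variables (c : {perm T}) (x0 : T).
Let C := porbit c x0.
Let H := pfixer C.
Hypothesis c_on : perm_on C c.

Lemma pfixer_cent_cycle y : y \in H -> commute y c.
Proof.
move=> /pfixerP fixy; have y_on : perm_on (~: C) y.
  by apply/subsetP=> x; rewrite !inE; apply: contra => /fixy->.
apply/perm.permP => x; rewrite !permM.
have [Cx|C'x] := boolP (x \in C); first by rewrite !fixy ?perm_closed.
rewrite (out_perm c_on C'x) (out_perm c_on) //.
by rewrite -in_setC (perm_closed _ y_on) in_setC.
Qed.

Lemma pfixer_cycle_dprod : H \x <[c]> = H <*> <[c]>.
Proof.
rewrite dprodEY //.
  by apply/centsP=> _ /cycleP[i ->] h Hh; apply/commute_sym/commuteX/pfixer_cent_cycle.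
apply/trivgP/subsetP => z /setIP[/pfixerP fixc /cycleP[i Dci]].
rewrite inE; apply/eqP/perm.permP => x; rewrite perm1.
have [/fixc//|C'x] := boolP (x \in C); rewrite Dci.
by elim: i {Dci} => [|i IHi]; rewrite ?perm1 // expgSr permM IHi (out_perm c_on).
Qed.

Definition coset_norm i : algC :=
  #|H|%:R^-1 * \sum_(h in H) `|'chi[G]_i (h * c)%g| ^+ 2.

(** Restricted to [H \x <[c]>], the character ['chi_i] has natural multiplicities [m]. Orthogonality
    on [H] then leaves only products of these with values at [c], all algebraic integers. *)
Lemma coset_norm_Aint i : coset_norm i \in Aint.
Proof.
have defK := pfixer_cycle_dprod; set K := (H <*> <[c]>)%G in defK.
have Nres : 'Res[K] 'chi[G]_i \is a character by rewrite cfRes_char ?irr_char.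
have [m mA Dchi] : exists2 m : Iirr H * Iirr <[c]> -> algC,
    forall jk, m jk \in Aint
  & forall h, h \in H ->
    'chi_i (h * c)%g = \sum_jk m jk * ('chi_jk.1 h * 'chi_jk.2 c).
  exists (fun jk => '['Res[K] 'chi_i, 'chi_(dprod_Iirr defK jk)]) => [jk | h Hh].
    by rewrite Aint_Cnat // Cnat_cfdot_char_irr.
  have Khc : (h * c)%g \in K.
    by rewrite groupM // mem_gen // inE ?Hh ?cycle_id ?orbT.
  rewrite -(cfResE _ (subsetT K) Khc) {1}['Res[K] _]cfun_sum_cfdot sum_cfunE.
  have bijI := Bijective (dprod_IirrK defK) (inv_dprod_IirrK defK).
  rewrite (reindex _ (onW_bij _ bijI)) /=.
  apply: eq_bigr => -[j k] _; rewrite !cfunE; congr (_ * _).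
  by rewrite dprod_IirrE cfDprodE ?cycle_id.
have -> : coset_norm i = \sum_jk \sum_jk'
   (m jk * 'chi_jk.2 c) * (m jk' * 'chi_jk'.2 c)^* * '['chi_jk.1, 'chi_jk'.1].
  rewrite /coset_norm mulr_sumr.
  transitivity (\sum_(h in H) \sum_jk \sum_jk'
    (m jk * 'chi_jk.2 c) * (m jk' * 'chi_jk'.2 c)^* *
    (#|H|%:R^-1 * ('chi_jk.1 h * ('chi_jk'.1 h)^*))).
    apply: eq_bigr => h Hh; rewrite normCK (Dchi h Hh) rmorph_sum /=.
    rewrite big_distrlr /= mulr_sumr.
    apply: eq_bigr => jk _; rewrite mulr_sumr; apply: eq_bigr => jk' _.
    rewrite !rmorphM /=; ring.
  rewrite exchange_big; apply: eq_bigr => jk _; rewrite exchange_big.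
  by apply: eq_bigr => jk' _; rewrite -mulr_sumr -mulr_sumr cfdotE.
rewrite rpred_sum // => jk _; rewrite rpred_sum // => jk' _.
by rewrite cfdot_irr rpredM ?rpred_nat // rpredM ?Aint_aut ?rpredM ?Aint_irr.
Qed.

Lemma coset_norm_ge1 i h : h \in H -> 'chi_i (h * c)%g != 0 -> 1 <= coset_norm i.
Proof.
move=> Hh nz; have sum_gt0 : 0 < coset_norm i.
  rewrite mulr_gt0 ?invr_gt0 ?gt0CG // (bigD1 h) //= ltr_wpDr ?exprn_gt0 ?normr_gt0 //.
  by rewrite sumr_ge0 // => ? _; rewrite exprn_ge0.
rewrite -(ger0_norm (ltW sum_gt0)) norm_intr_ge1 ?gt_eqF //.
apply: Cint_rat_Aint (coset_norm_Aint i).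
rewrite rpredM ?rpredV ?rpred_nat // rpred_sum // => y _.
by rewrite normCK -irr_inv rpredM ?char_Sym_Crat ?irr_char.
Qed.

(** Apply orbit-stabilizer at [x0]. A centralizing [y] that fixes [x0] fixes its whole orbit under
    [h * c], which is [C]; so [y] is in [H], commutes with [c], and hence with [h]. *)
Lemma card_cent1_coset h : h \in H -> (#|'C[h * c]%g| <= #|T| * #|'C_H[h]%g|)%N.
Proof.
move=> Hh; rewrite -(card_orbit_stab 'P 'C[h * c]%G x0) leq_mul ?max_card //.
apply/subset_leq_card/subsetP => y /setIP[Cy /astab1P/= yx0].
have hcx0 i : ((h * c) ^+ i)%g x0 = (c ^+ i)%g x0.
  rewrite expgMn; last exact: pfixer_cent_cycle.
  by rewrite permM (pfixerP _ _ (groupX i Hh)) ?porbit_id.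
have Hy : y \in H.
  apply/pfixerP => x /porbitP[i ->]; rewrite -hcx0 -permM.
  by rewrite -(commuteX i (cent1P Cy)) permM [y x0]yx0.
rewrite inE Hy; apply/cent1P.
have := commuteM (cent1P Cy) (commuteV (pfixer_cent_cycle Hy)).
by rewrite mulgK.
Qed.

Lemma sum_coset_norm : \sum_i coset_norm i <= (#|T| * #|classes H|)%:R.
Proof.
rewrite /coset_norm -mulr_sumr exchange_big /=.
rewrite mulrC ler_pdivrMr ?gt0CG // -natrM -mulnA [(#|classes _| * _)%N]mulnC.
rewrite -sum_card_cent1 big_distrr natr_sum ler_sum // => h Hh.
by rewrite sum_norm_irr_perm ler_nat card_cent1_coset.
Qed.

Lemma card_coset_nonvanishing :
  (#|[set i : Iirr G | [exists h in H, 'chi_i (h * c)%g != 0%R]]|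
     <= #|T| * #|partitions #|~: C| |)%N.
Proof.
apply: leq_trans (leq_mul (leqnn _) (card_classes_pfixer C)).
rewrite -(ler_nat algC); apply: le_trans sum_coset_norm.
set B := [set i | _]; rewrite -sum1_card natr_sum [X in _ <= X](bigID [in B]) /=.
have ge0 i : 0 <= coset_norm i.
  by rewrite mulr_ge0 ?invr_ge0 ?ler0n // sumr_ge0 // => ? _; rewrite exprn_ge0.
rewrite ler_wpDr ?sumr_ge0 // ler_sum // => i; rewrite inE.
by case/exists_inP=> h Hh /(coset_norm_ge1 Hh).
Qed.

End FixedCycle.

Lemma perm_conj_cycle s1 s2 (b1 b2 : seq T) :
    size b1 = size b2 -> uniq b1 -> uniq b2 -> fcycle s1 b1 -> fcycle s2 b2 ->
  exists y, {in b2, (s1 ^ y)%g =1 s2}.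
Proof.
move=> eq_sz U1 U2 cyc1 cyc2.
(* Completing both cycles to enumerations of [T] extends their matching to a permutation. *)
pose ext b := b ++ [seq x <- enum T | x \notin b].
have extU b : uniq b -> uniq (ext b).
  move=> Ub; rewrite cat_uniq Ub filter_uniq ?enum_uniq // andbT.
  by apply/hasPn => x; rewrite mem_filter => /andP[].
have extT b : ext b =i T.
  by move=> x; rewrite mem_cat mem_filter mem_enum andbT; case: (x \in b).
have [y Dy] := perm_map_seq (extU _ U1) (extU _ U2) (extT b1) (extT b2).
have {}Dy : map y b1 = b2.
  by move: Dy => /(congr1 (take (size b2))); rewrite map_cat !take_size_cat ?size_map.
exists y => z b2z; have /mapP[x b1x Dz] : z \in map y b1 by rewrite Dy.
rewrite {1}Dz permJ; have /eqP -> := next_cycle cyc1 b1x.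
by rewrite -(next_map (@perm_inj _ y)) // Dy -Dz; have /eqP -> := next_cycle cyc2 b2z.
Qed.

Definition nonvanishing_cycle t : {set Iirr G} :=
  [set i : Iirr G | [exists s : {perm T},
     [exists x, #|porbit s x| == t] && ('chi_i s != 0)]].

(** Let [c] be the [t]-cycle of one witness, extended by fixed points. Every permutation with a
    [t]-cycle is conjugate into the coset of [c], and characters are class functions. *)
Lemma card_nonvanishing_cycle t :
  (#|nonvanishing_cycle t| <= #|T| * #|partitions (#|T| - t)|)%N.
Proof.
have [->|[i0]] := set_0Vmem (nonvanishing_cycle t); first by rewrite cards0.
rewrite inE => /existsP[s0 /andP[/existsP[x0 /eqP Dt] _]].
set D := porbit s0 x0 in Dt; pose c := restr_perm D s0.
have nD : s0 \in 'N(D | 'P)%g.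
  apply/astabsP=> x; rewrite /= apermE -!eq_porbit_mem.
  by have := porbit_perm s0 1 x; rewrite expg1 => ->.
have Dc : porbit c x0 = D.
  have cE i : (c ^+ i)%g x0 = (s0 ^+ i)%g x0.
    elim: i => [|i IHi]; first by rewrite !expg0.
    by rewrite !expgSr !permM IHi restr_permE ?mem_porbit.
  by apply/setP=> x; apply/porbitP/porbitP => -[i ->]; exists i; rewrite cE.
have c_on : perm_on (porbit c x0) c by rewrite Dc restr_perm_on.
have -> : (#|T| - t)%N = #|~: porbit c x0| by rewrite Dc cardsCs setCK -Dt.
apply: leq_trans (card_coset_nonvanishing c_on); apply/subset_leq_card/subsetP => i.
rewrite !inE => /existsP[s /andP[/existsP[x /eqP st] nz]].
have blockU (u : {perm T}) z : uniq (cycle_block u (porbit u z)).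
  have [sz memE _] := cycle_blockP u z; apply/card_uniqP.
  by rewrite sz; apply: eq_card.
have [sz1 mem1 cyc1] := cycle_blockP s x.
have [sz2 mem2 cyc2] := cycle_blockP c x0.
have eq_sz : size (cycle_block s (porbit s x)) = size (cycle_block c (porbit c x0)).
  by rewrite sz1 sz2 st Dc -Dt.
have [y sy] := perm_conj_cycle eq_sz (blockU s x) (blockU c x0) cyc1 cyc2.
apply/exists_inP; exists (s ^ y * c^-1)%g.
  by apply/pfixerP => z Cz; rewrite permM sy ?permK // mem2.
by rewrite mulgKV cfunJ ?inE.
Qed.

End CycleVanishing.

(** * Divisibility from vanishing on prime power cycles *)

Section CycleDivisibility.

Import GroupScope Order.TTheory GRing.Theory Num.Theory.
Local Open Scope ring_scope.

Variables (T : finType) (c : {perm T}) (x0 : T).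
Hypothesis c_on : perm_on (porbit c x0) c.

Let G := [set: {perm T}]%G.
Let H := pfixer (porbit c x0).

(** Powers of [c] commute and move only the orbit of [x0], so each is determined by the image of
    [x0]. *)
Lemma card_porbit_cycle u : u \in <[c]>%g -> #|porbit u x0| = #[u]%g.
Proof.
move=> cu; have cuP : <[u]>%g \subset <[c]>%g by rewrite cycle_subG.
rewrite porbit.unlock card_in_imset // => y z uy uz /= eq_yz.
have cy := subsetP cuP _ uy; have cz := subsetP cuP _ uz.
have comm v w : v \in <[c]>%g -> w \in <[c]>%g -> commute v w.
  by move=> cv cw; apply: (centsP (cycle_abelian c)).
apply/perm.permP => x; have [|C'x] := boolP (x \in porbit c x0).
  case/porbitP=> i ->; rewrite -!permM -(comm y) -?(comm z) ?mem_cycle // !permM.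
  by congr (_ _); apply: eq_yz.
have outc v : v \in <[c]>%g -> v x = x.
  case/cycleP=> i ->; elim: i => [|i IHi]; first by rewrite perm1.
  by rewrite expgSr permM IHi (out_perm c_on).
by rewrite !outc.
Qed.

Lemma porbit_pfixer_mul h u :
  h \in H -> u \in <[c]>%g -> porbit (h * u)%g x0 = porbit u x0.
Proof.
move=> Hh cu; have hu i : ((h * u) ^+ i)%g x0 = (u ^+ i)%g x0.
  rewrite expgMn; last first.
    by case/cycleP: cu => j ->; apply: commuteX; apply: (pfixer_cent_cycle c_on).
  by rewrite permM (pfixerP _ _ (groupX i Hh)) ?porbit_id.
by apply/setP=> x; apply/porbitP/porbitP => -[i ->]; exists i; rewrite hu.
Qed.

Lemma dvdA_char_cycle (chi : 'CF(G)) g p N e :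
    prime p -> (e <= N)%N -> #|porbit c x0| = (p ^ N)%N -> g \in H ->
    chi \is a character ->
    (forall v s x, (v < e)%N -> #|porbit s x| = (p ^ (N - v))%N -> chi s = 0) ->
  ((p ^ e)%:R %| chi g)%A.
Proof.
move=> p_pr leeN Dc Hg Nchi vanish.
have p_gt0 := prime_gt0 p_pr.
have ord_c : #[c]%g = (p ^ N)%N by rewrite -card_porbit_cycle ?cycle_id.
have cH u : u \in <[c]>%g -> commute g u.
  by case/cycleP=> j ->; apply: commuteX; apply: (pfixer_cent_cycle c_on).
have dprodg u : u \in <[c]>%g -> <[g]> \x <[u]> = <[g]> <*> <[u]>.
  move=> cu; rewrite dprodEY //.
    rewrite cycle_subG; apply/centP => _ /cycleP[i ->].
    exact/commuteX/commute_sym/cH.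
  apply/trivgP; have /dprodP[_ _ _ <-] := pfixer_cycle_dprod c_on.
  by apply: setISS; rewrite cycle_subG.
set q := (c ^+ (p ^ e))%g; have cq : q \in <[c]>%g by apply: mem_cycle.
(* The index of [K] in [A] is exactly [p ^ e], so it suffices that [chi] vanishes on [A] outside
   [K]. *)
pose A := (<[g]> <*> <[c]>)%G; pose K := (<[g]> <*> <[q]>)%G.
have sKA : K \subset A by rewrite genS // setUS // cycle_subG.
have ord_q : #[q]%g = (p ^ (N - e))%N.
  by rewrite orderXdiv ord_c ?dvdn_exp2l // -expnB.
have index_K : #|A : K|%g = (p ^ e)%N.
  rewrite -divgS // -(dprod_card (dprodg _ (cycle_id c))) -(dprod_card (dprodg _ cq)).
  rewrite -!orderE ord_c ord_q divnMl ?order_gt0 // -expnB ?leq_subr //.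
  by rewrite subKn.
have centg u : u \in <[c]>%g -> (<[u]> \subset 'C(<[g]>))%g.
  by move=> cu; have /dprodP[_ _ ->] := dprodg u cu.
have abA : abelian A.
  by rewrite abelianY !cycle_abelian /= centg ?cycle_id.
have gK : g \in K by rewrite mem_gen // inE cycle_id.
have gA := subsetP sKA g gK.
rewrite -(cfResE chi (subsetT A) gA) -index_K.
apply: dvdA_char_support => //; first exact: cfRes_char.
apply/cfun_onP => x K'x; have [Ax|/cfun0->//] := boolP (x \in A).
rewrite cfResE ?subsetT //.
have: x \in (<[g]> * <[c]>)%g by rewrite -cent_joinEr // centg ?cycle_id.
case/mulsgP=> y _ gy /cycleP[i ->] Dx.
have Hy : y \in H by apply: subsetP gy; rewrite cycle_subG.
(* Otherwise [c ^+ i] would be a power of [q], putting [x] in [K]. So [v = logn p i] is below [e],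
   and the orbit of [x0] under [x] has [#[c ^+ i] = p ^ (N - v)] points. *)
have ndvd : ~~ (p ^ e %| i)%N.
  apply: contra K'x => /dvdnP[m Dm]; rewrite Dx groupM //.
    by rewrite mem_gen // inE gy.
  by rewrite Dm mulnC expgM groupX // mem_gen // inE cycle_id orbT.
have i_gt0 : (0 < i)%N by case: (i) ndvd => //; rewrite dvdn0.
rewrite pfactor_dvdn // -ltnNge in ndvd.
apply: (vanish (logn p i) x x0 ndvd).
rewrite Dx porbit_pfixer_mul ?mem_cycle // card_porbit_cycle ?mem_cycle //.
rewrite orderXgcd ord_c [in RHS]expnB //; last first.
  by apply: leq_trans leeN; apply: ltnW.
congr (_ %/ _)%N.
have [m p'm Di] := pfactor_coprime p_pr i_gt0.
rewrite {1}Di Gauss_gcdr ?coprimeXl //.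
by apply/gcdn_idPr/dvdn_exp2l/ltnW/(leq_trans ndvd).
Qed.

End CycleDivisibility.

(** * Constituents of Specht modules *)

Section CyclicModules.

Import GroupScope Order.TTheory GRing.Theory Num.Theory.
Local Open Scope ring_scope.

Variables (gT : finGroupType) (G : {group gT}).
Local Notation aG := (regular_repr algC G).
Local Notation R_G := (group_ring algC G).

Lemma Wedderburn_id_gring (W : DecSocleType aG) : (Wedderburn_id W \in R_G)%MS.
Proof.
by have := Wedderburn_id_mem W; rewrite genmxE => /submx_trans; apply; apply: submxMl.
Qed.

(** With [e] the identity of a two-sided ideal, both [D e] and [e D] lie in the ideal, so both equal
    [e D e]. *)
Lemma Wedderburn_id_comm (W : DecSocleType aG) D :
  (D \in R_G)%MS -> D *m Wedderburn_id W = Wedderburn_id W *m D.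
Proof.
move=> RD; have Re := Wedderburn_id_gring W.
have /andP[idl idr] := Wedderburn_ideal W.
have C'G := algC'G_pchar G.
have [_ eR ide eid] := Wedderburn_is_id_pchar C'G W.
have De : (D *m Wedderburn_id W \in Wedderburn_subring W)%MS.
  by apply: (mulsmx_subP idl).
have eD : (Wedderburn_id W *m D \in Wedderburn_subring W)%MS.
  by apply: (mulsmx_subP idr).
by rewrite -(ide _ De) mulmxA (eid _ eD).
Qed.

(** If [u] acts as zero in the irreducible representation, its product with the central idempotent
    of that component is zero, so the idempotent kills the module generated by [u]. *)
Lemma cfdot_cyclic_repr_eq0 (u : 'rV_#|G|) i :
    gring_mx 'Chi_i u = 0 ->
  '[cfRepr (submod_repr (cyclic_mx_module aG u)), 'chi_i] = 0.
Proof.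
move=> Cu0; set M := cyclic_mx aG u; set rM := submod_repr _.
set W := @socle_of_Iirr _ G i; have C'G := algC'G_pchar G.
have Re := Wedderburn_id_gring W.
have Yu0 : gring_mx aG u *m Wedderburn_id W = 0.
  apply/eqP; rewrite -mxvec_eq0 -submx0.
  rewrite -(ker_irr_comp_op_pchar (DecSocleType aG) C'G (socle_irr W)).
  rewrite irr_reprK_pchar // sub_capmx; apply/andP; split.
    have /andP[idl _] := Wedderburn_ideal W.
    by apply: (mulsmx_subP idl); rewrite ?gring_mxP ?Wedderburn_id_mem.
  apply/sub_kermxP; rewrite mul_vec_lin /= gring_opM // gring_op_mx Cu0.
  by rewrite mul0mx linear0.
have ue0 : u *m Wedderburn_id W = 0 by rewrite -[u]gring_mxK -gring_row_mul Yu0 linear0.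
have Me0 : gring_op rM (Wedderburn_id W) = 0.
  have valM D : (D \in R_G)%MS -> val_submod (gring_op rM D) = val_submod 1%:M *m D.
    case/envelop_mxP=> a ->; rewrite !linear_sum /=; apply: eq_bigr => x Gx.
    by rewrite !linearZ /= gring_opG // -{1}[rM x]mul1mx val_submodJ.
  apply/eqP; rewrite -(val_submod_eq0 (U := M)) valM //.
  apply/eqP/row_matrixP => k; rewrite row_mul row0.
  have /cyclic_mxP[D RD ->] : (row k (val_submod 1%:M) <= M)%MS.
    by apply: submx_trans (row_sub _ _) _; rewrite val_submod1.
  by rewrite -mulmxA Wedderburn_id_comm // mulmxA ue0 mul0mx.
(* The linear extension of the character takes at the idempotent the value multiplicity times
   degree. *)
have : (cfRepr rM).[Wedderburn_id W]%CF = 0 by rewrite xcfun_repr Me0 mxtrace0.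
rewrite {1}[cfRepr rM]cfun_sum_cfdot -xcfun_rE raddf_sum /= (bigD1 i) //=.
rewrite big1 ?addr0 => [|j ne_ji]; last by rewrite xcfunZl xcfun_id (negPf ne_ji) mulr0.
rewrite xcfunZl xcfun_id eqxx => /eqP.
by rewrite mulf_eq0 (negPf (irr1_neq0 i)) orbF => /eqP.
Qed.

(** A nonzero row of [A] generates the whole irreducible module; if all products vanished, [B] would
    kill that module. *)
Lemma irr_mx_mul_neq0 n (rG : mx_representation algC G n) (A B : 'M_n) :
    mx_irreducible rG -> A != 0 -> B != 0 ->
  exists2 x, x \in G & A *m rG x *m B != 0.
Proof.
move=> /mx_irrP[_ irrG] nzA nzB; apply/exists_inP; apply: contraNT nzB.
move=> /exists_inPn AxB0; have [k nzAk] : exists k, row k A != 0.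
  apply/existsP; apply: contraNT nzA => /existsPn A0.
  by apply/eqP/row_matrixP=> k; rewrite row0; apply/eqP/negPn/A0.
have full : row_full (cyclic_mx rG (row k A)).
  by rewrite irrG ?cyclic_mx_module ?cyclic_mx_eq0.
apply/eqP/row_matrixP=> l; rewrite row0 rowE.
have /cyclic_mxP[D /envelop_mxP[a ->] ->] := submx_full (delta_mx 0 l : 'rV_n) full.
rewrite mulmx_sumr mulmx_suml big1 // => x Gx.
rewrite -scalemxAr -scalemxAl -!row_mul.
by have /negPn/eqP-> := AxB0 x Gx; rewrite row0 scaler0.
Qed.

End CyclicModules.

(** * Dominance order on partitions *)

Section Dominance.

Local Open Scope nat_scope.

Lemma partition_sumn_take_inj n (la mu : seq nat) :
    is_partition n la -> is_partition n mu ->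
    (forall r, sumn (take r la) = sumn (take r mu)) ->
  la = mu.
Proof.
case/and3P=> _ pla _ /and3P[_ pmu _]; elim: la mu pla pmu => [|a la IH] [|b mu] //=.
- by move=> _ /andP[b_gt0 _] /(_ 1) /=; rewrite take0 addn0 => b0; rewrite -b0 in b_gt0.
- by move=> /andP[a_gt0 _] _ /(_ 1) /=; rewrite take0 addn0 => a0; rewrite a0 in a_gt0.
move=> /andP[_ pla] /andP[_ pmu] eq_r; have := eq_r 1.
rewrite /= !take0 !addn0 => eq_ab; congr (_ :: _) => //.
by apply: IH => // r; have := eq_r r.+1; rewrite /= eq_ab => /addnI.
Qed.

Lemma reshape_index_lt sh r i : i < sumn sh ->
  (reshape_index sh i < r) = (i < sumn (take r sh)).
Proof.
move=> lti; have lt_off := reshape_offsetP lti.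
have lt_row := reshape_indexP lti.
rewrite -{2}(reshape_indexK sh i) /flatten_index.
set q := reshape_index sh i in lt_off lt_row *.
have take_le u v : u <= v -> sumn (take u sh) <= sumn (take v sh).
  by move=> /subnKC <-; rewrite takeD sumn_cat leq_addr.
case: (ltnP q r) => [ltqr|leqr]; apply/esym.
  apply: leq_trans (take_le _ _ ltqr).
  by rewrite (take_nth 0) // sumn_rcons ltn_add2l.
by apply/negbTE; rewrite -leqNgt (leq_trans (take_le _ _ leqr)) ?leq_addr.
Qed.

Lemma card_reshape_index_lt n la r : is_partition n la ->
  #|[set i : 'I_n | reshape_index la i < r]| = sumn (take r la).
Proof.
case/and3P=> _ _ /eqP sum_la.
have le_n : sumn (take r la) <= n.
  by rewrite -sum_la -{2}(cat_take_drop r la) sumn_cat leq_addr.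
rewrite -sum1_card -[RHS]card_ord -[RHS]sum1_card -(big_ord_narrow (F := fun=> 1) le_n).
by apply: eq_bigl => i; rewrite inE reshape_index_lt ?sum_la.
Qed.

(** Count along each column of [mu]. The first [r] rows of [la] send at most one cell each into it,
    hence at most the smaller of [r] and the column length, which is what the first [r] rows of [mu]
    contain of it. *)
Lemma dominance n la mu (x : 'S_n) :
    is_partition n la -> is_partition n mu ->
    (forall i j : 'I_n, reshape_index la i = reshape_index la j ->
       reshape_offset mu (x i) = reshape_offset mu (x j) -> i = j) ->
  forall r, sumn (take r la) <= sumn (take r mu).
Proof.
move=> la_n mu_n inj_x r.
rewrite -(card_reshape_index_lt r la_n) -(card_reshape_index_lt r mu_n).
have /and3P[mu_sorted _ /eqP sum_mu] := mu_n.
pose col (y : 'I_n) : 'I_n.+1 := inord (reshape_offset mu y).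
have colE y : val (col y) = reshape_offset mu y.
  rewrite /= inordK // ltnS; apply: leq_trans (ltnW (ltn_ord y)).
  by rewrite -{2}(reshape_indexK mu y) leq_addl.
rewrite -!sum1_card (partition_big (col \o x) xpredT) //=.
rewrite [X in _ <= X](partition_big col xpredT) //=; apply: leq_sum => j _.
rewrite !sum1dep_card.
(* Either column [j] reaches row [r], and [r] separates the two counts, or it lies within the first
   [r] rows and [x] maps the left set into the right one. *)
have [/exists_inP[y0 /eqP col_y0 le_r]|/exists_inPn all_lt] :=
    boolP [exists (y | col y == j), r <= reshape_index mu y]; last first.
  rewrite -(card_imset _ (@perm_inj _ x)); apply/subset_leq_card/subsetP => y.
  case/imsetP=> i; rewrite !inE => /andP[_ col_i] ->.
  by rewrite col_i andbT ltnNge (all_lt _ col_i).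
apply: (@leq_trans r).
  rewrite -[leqRHS]card_ord -cardsT.
  apply: (leq_card_rel (r := fun (i : 'I_n) (q : 'I_r) => reshape_index la i == q)).
    by move=> i; rewrite !inE => /andP[lt_r _]; exists (Ordinal lt_r); rewrite ?inE /=.
  move=> i i'; rewrite !inE => /andP[_ /eqP cx] /andP[_ /eqP cx'] q /eqP ri /eqP ri'.
  by apply: inj_x; rewrite ?ri // -!colE cx cx'.
rewrite -[leqLHS]card_ord -cardsT.
(* The parts of [mu] decrease weakly, so each row above that of [y0] also meets column [j]. *)
have lt_box q : q < r -> j < nth 0 mu q.
  move=> ltqr; have lt_y0 : y0 < sumn mu by rewrite sum_mu.
  have lt_sz := reshape_indexP lt_y0; have lt_col := reshape_offsetP lt_y0.
  have lt_q : q < reshape_index mu y0 by apply: leq_trans le_r.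
  rewrite -col_y0 colE (leq_trans lt_col) //.
  have geq_trans : transitive geq by move=> a b c /= ab ca; apply: leq_trans ca ab.
  apply: (sorted_leq_nth geq_trans leqnn 0 mu_sorted); last exact: ltnW.
    by rewrite inE; apply: ltn_trans lt_q lt_sz.
  by rewrite inE.
apply: (leq_card_rel (r := fun (q : 'I_r) (y : 'I_n) => reshape_index mu y == q)).
  move=> q _; have lt_j := lt_box q (ltn_ord q).
  have lt_n : flatten_index mu q j < n.
    by have := flatten_indexP lt_j; rewrite sum_mu.
  exists (Ordinal lt_n); last by rewrite /= flatten_indexKl.
  rewrite !inE /= flatten_indexKl // ltn_ord /=; apply/eqP/val_inj.
  by rewrite colE /= flatten_indexKr.
by move=> q q' _ _ y /eqP -> /eqP/val_inj.
Qed.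

End Dominance.

(** * Specht characters of distinct shapes share no constituent *)

Section SpechtOrthogonality.

Import GroupScope Order.TTheory GRing.Theory Num.Theory.
Local Open Scope ring_scope.

Variable n : nat.
Let G := [set: 'S_n]%G.

Section Representation.

Variables (m : nat) (rG : mx_representation algC G m).
Implicit Types la mu : seq nat.

Definition row_sum la : 'M_m := \sum_(g in row_stabilizer n la) rG g.
Definition col_sum la : 'M_m :=
  \sum_(h in col_stabilizer n la) (-1) ^+ odd_perm h *: rG h.

Lemma gring_mx_young_symmetrizer la :
  gring_mx rG (young_symmetrizer n la) = row_sum la *m col_sum la.
Proof.
rewrite linear_sum mulmx_suml; apply: eq_bigr => g _.
rewrite linear_sum mulmx_sumr; apply: eq_bigr => h _.
rewrite linearZ /= -scalemxAr -repr_mxM ?inE //; congr (_ *: _).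
by rewrite /gring_mx /= -rowE rowK mxvecK gring_indexK ?inE.
Qed.

Lemma row_sum_tperm la (i j : 'I_n) :
  reshape_index la i = reshape_index la j -> row_sum la *m rG (tperm i j) = row_sum la.
Proof.
move=> eq_ij; rewrite mulmx_suml /row_sum [RHS](reindex_inj (mulIg (tperm i j))) /=.
apply: eq_big => [g|g _]; last by rewrite repr_mxM ?inE.
rewrite !inE; apply: eq_forallb => k; rewrite permM.
by case: tpermP => [->|->|//]; rewrite eq_ij.
Qed.

Lemma col_sum_tperm mu (i j : 'I_n) : i != j ->
    reshape_offset mu i = reshape_offset mu j ->
  rG (tperm i j) *m col_sum mu = - col_sum mu.
Proof.
move=> ne_ij eq_ij; rewrite mulmx_sumr /col_sum -sumrN.
rewrite [RHS](reindex_inj (mulgI (tperm i j))) /=.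
apply: eq_big => [h|h _].
  rewrite !inE; apply/forallP/forallP => col_h k; last first.
    have := col_h (tperm i j k); rewrite permM tpermK.
    by case: tpermP => [->|->|//]; rewrite eq_ij.
  by rewrite permM (eqP (col_h _)); case: tpermP => [->|->|//]; rewrite eq_ij.
rewrite -scalemxAr -repr_mxM ?inE // odd_permM odd_tperm ne_ij.
rewrite -scaleNr; congr (_ *: _).
by case: (odd_perm h); rewrite /= ?expr0 ?expr1 ?opprK.
Qed.

(** If [i] and [j] differed, inserting their transposition after the row sum would change nothing,
    while moved past [x] it would change the sign of the column sum. *)
Lemma row_sum_col_sum_neq0 la mu (x : 'S_n) (i j : 'I_n) :
    row_sum la *m rG x *m col_sum mu != 0 ->
    reshape_index la i = reshape_index la j ->
    reshape_offset mu (x i) = reshape_offset mu (x j) ->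
  i = j.
Proof.
move=> nz eq_row eq_col; apply: contraNeq nz => ne_ij.
set X := _ *m col_sum mu; suff : X = - X.
  move/eqP; rewrite -subr_eq0 opprK -mulr2n -scaler_nat scaler_eq0 pnatr_eq0.
  by [].
rewrite {1}/X -(row_sum_tperm eq_row) -[_ *m rG x]mulmxA -repr_mxM ?inE //.
rewrite (_ : tperm i j * x = x * tperm (x i) (x j))%g; last first.
  by rewrite -tpermJ conjgC.
rewrite repr_mxM ?inE // mulmxA -[_ *m col_sum mu]mulmxA col_sum_tperm ?mulmxN //.
by rewrite (inj_eq perm_inj).
Qed.

End Representation.

Lemma specht_constt_sums la i :
    '[specht_character n la, 'chi_i] != 0 ->
  row_sum 'Chi_i la != 0 /\ col_sum 'Chi_i la != 0.
Proof.
move=> nz; have : gring_mx 'Chi_i (young_symmetrizer n la) != 0.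
  by apply: contraNneq nz => /cfdot_cyclic_repr_eq0 ->.
rewrite gring_mx_young_symmetrizer => nz_AB.
by split; apply: contraNneq nz_AB => ->; rewrite ?mul0mx ?mulmx0.
Qed.

(** In the common constituent the row sum of [la] and the column sum of [mu] are nonzero; by
    irreducibility some [x] makes their product through it nonzero. *)
Lemma specht_constt_dominance la mu i :
    is_partition n la -> is_partition n mu ->
    '[specht_character n la, 'chi_i] != 0 ->
    '[specht_character n mu, 'chi_i] != 0 ->
  forall r, (sumn (take r la) <= sumn (take r mu))%N.
Proof.
move=> la_n mu_n /specht_constt_sums[nz_la _] /specht_constt_sums[_ nz_mu].
have [x _ nz] := irr_mx_mul_neq0 (socle_irr (socle_of_Iirr i)) nz_la nz_mu.
by apply: (dominance (x := x)) => // j k; apply: row_sum_col_sum_neq0 nz.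
Qed.

Lemma specht_constt_inj la mu i :
    is_partition n la -> is_partition n mu ->
    '[specht_character n la, 'chi_i] != 0 ->
    '[specht_character n mu, 'chi_i] != 0 ->
  la = mu.
Proof.
move=> la_n mu_n nz_la nz_mu; apply: (partition_sumn_take_inj la_n mu_n) => r.
apply/eqP; rewrite eqn_leq; apply/andP; split.
  exact: (specht_constt_dominance la_n mu_n nz_la nz_mu).
exact: (specht_constt_dominance mu_n la_n nz_mu nz_la).
Qed.

End SpechtOrthogonality.

(** * Growth of the number of partitions *)

Section PartitionGrowth.

Local Open Scope nat_scope.

Lemma parts_inj n : injective (@parts n).
Proof. by move=> la mu /(inj_map val_inj)/val_inj. Qed.

Lemma card_partitions_gt0 n : 0 < #|partitions n|.
Proof.
have [|nu nu_n _] := @partitions_surj n (nseq n 1).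
  rewrite /is_partition all_nseq orbT sumn_nseq mul1n eqxx /= andbT.
  by case: n => // n; elim: n => //= n ->.
by rewrite card_gt0; apply/set0Pn; exists nu.
Qed.

Lemma is_partition_cons_sort n k s : k <= n -> 0 < k ->
  is_partition (n - k) s -> is_partition n (sort geq (k :: s)).
Proof.
move=> le_kn k_gt0 /and3P[_ s_gt0 /eqP sum_s]; apply/and3P; split.
- by apply: sort_sorted => a b; apply: leq_total.
- by rewrite all_sort /= k_gt0.
by rewrite (perm_sumn (permEl (perm_sort _ _))) /= sum_s subnKC.
Qed.

(** Inserting a part [k] is injective, as the remaining multiset of parts can be recovered. *)
Lemma card_partitions_part n k : k <= n -> 0 < k ->
  #|partitions (n - k)| <= #|[set la in partitions n | k \in parts la]|.
Proof.
move=> le_kn k_gt0.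
apply: (leq_card_rel (r := fun la nu => parts nu == sort geq (k :: parts la))).
  move=> la; rewrite inE => la_part.
  have [nu nu_n Dnu] := partitions_surj (is_partition_cons_sort le_kn k_gt0 la_part).
  by exists nu; rewrite ?Dnu // inE nu_n Dnu mem_sort mem_head.
move=> la mu; rewrite !inE => /and3P[s_la _ _] /and3P[s_mu _ _] nu /eqP -> /eqP eq_s.
apply: parts_inj; apply: (sorted_eq (leT := geq)) => //.
- by move=> a b c /= ab ca; apply: leq_trans ca ab.
- by move=> a b /andP[] /= ba ab; apply/eqP; rewrite eqn_leq ab.
rewrite -(perm_cons k) -(permPl (permEl (perm_sort geq _))) eq_s.
exact: permEl (perm_sort _ _).
Qed.

Lemma leq_card_partitions m n : m <= n -> #|partitions m| <= #|partitions n|.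
Proof.
move=> /subnKC <-; elim: (n - m) => [|r IH]; first by rewrite addn0.
apply: leq_trans IH _; rewrite addnS.
have := @card_partitions_part (m + r).+1 1 isT isT.
rewrite subn1 => /leq_trans; apply.
by apply/subset_leq_card/subsetP=> la; rewrite inE => /andP[].
Qed.

Lemma sum_distinct_parts s m : \sum_(k < m | val k \in s) k <= sumn s.
Proof.
elim: s => [|x s IHs] /=; first by rewrite big_pred0.
apply: leq_trans (leq_add (leqnn x) IHs).
apply: (@leq_trans (\sum_(k < m | val k == x) k + \sum_(k < m | val k \in s) k)).
  rewrite big_mkcond [X in _ <= X + _]big_mkcond [X in _ <= _ + X]big_mkcond -big_split.
  by apply: leq_sum => k _; rewrite inE; case: eqP => //= _; rewrite leq_addr.
rewrite leq_add2r; have [lt_xm|le_mx] := ltnP x m.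
  by rewrite (big_pred1 (Ordinal lt_xm)).
rewrite big_pred0 // => k; apply/negbTE; apply: contraTneq le_mx => <-.
by rewrite -ltnNge ltn_ord.
Qed.

(* Count the pairs (la, k) with k a part of la, weighted by k. *)
Lemma partitions_growth n m : m <= n ->
  m ^ 2 * #|partitions (n - m)| <= 2 * n * #|partitions n|.
Proof.
move=> le_mn.
have sum_le : \sum_(k < m.+1) k * #|partitions (n - k)| <= n * #|partitions n|.
  rewrite mulnC -sum_nat_const.
  apply: (@leq_trans (\sum_(la in partitions n)
                        \sum_(k < m.+1 | val k \in parts la) k)).
    rewrite (exchange_big_dep predT) //=; apply: leq_sum => k _.
    rewrite sum_nat_cond_const mulnC leq_mul2r; apply/orP.
    have [->|k_gt0] := posnP k; first by left.
    right; have le_kn : k <= n by rewrite -ltnS (leq_trans (ltn_ord k)).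
    apply: leq_trans (card_partitions_part le_kn k_gt0) _.
    by apply/subset_leq_card/subsetP=> la; rewrite !inE.
  apply: leq_sum => la; rewrite inE => /and3P[_ _ /eqP sum_la].
  by apply: leq_trans (sum_distinct_parts _ _) _; rewrite sum_la.
apply: leq_trans (_ : 2 * (\sum_(k < m.+1) k * #|partitions (n - k)|) <= _); last first.
  by rewrite -mulnA leq_mul2l.
apply: (@leq_trans (2 * \sum_(k < m.+1) k * #|partitions (n - m)|)).
  rewrite -big_distrl /= mulnA leq_mul2r; apply/orP; right.
  elim: (m) => [|r IHr]; first by rewrite exp0n.
  by rewrite big_ord_recr /= mulnDr; move: IHr; rewrite -!mulnn; lia.
rewrite leq_mul2l /=; apply: leq_sum => k _; rewrite leq_mul2l.
by apply/orP; right; apply: leq_card_partitions; rewrite leq_sub2l // -ltnS.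
Qed.

(** Remove [t./2] twice. For [t] proportional to [n], one use of [partitions_growth] saves only a
    factor [n], which the bound [n * p(n - t)] absorbs; two uses save [n ^ 2]. *)
Lemma partitions_growth2 n t : t <= n ->
  t./2 ^ 4 * #|partitions (n - t)| <= 4 * n ^ 2 * #|partitions n|.
Proof.
move=> le_tn; set m := t./2.
have le_2m : m + m <= t by rewrite addnn -[t in _ <= t]odd_double_half leq_addl.
have le_m : m <= n - m by lia.
have le_mn : m <= n by lia.
have H1 := partitions_growth le_mn.
have H2 := partitions_growth le_m.
have H3 : #|partitions (n - t)| <= #|partitions (n - m - m)|.
  by apply: leq_card_partitions; lia.
move: H1 H2 H3; set P0 := #|_|; set P1 := #|_|; set P2 := #|_|; set P3 := #|_|.
nia.
Qed.

End PartitionGrowth.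

(** * Counting *)

Section SpechtDivisibility.

Import GroupScope Order.TTheory GRing.Theory Num.Theory.
Local Open Scope nat_scope.

Lemma perm_single_cycle (T : finType) (X : {set T}) x0 : x0 \in X ->
  exists2 c : {perm T}, perm_on X c & porbit c x0 = X.
Proof.
move=> Xx0; pose f x := if x \in X then next (enum X) x else x.
have Xf x : (f x \in X) = (x \in X).
  by rewrite /f; case: ifP => // Xx; rewrite -mem_enum mem_next mem_enum.
have f_inj : injective f.
  move=> x y eq_f; have eqX : (x \in X) = (y \in X) by rewrite -Xf eq_f Xf.
  by move: eq_f; rewrite /f -eqX; case: ifP => _ //; apply/can_inj/prev_next/enum_uniq.
exists (perm f_inj).
  by apply/subsetP => x; rewrite inE permE /f; case: ifP => // _; rewrite eqxx.
have fc : fcycle (perm f_inj) (enum X).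
  apply: (sub_in_cycle (P := [in X])) (cycle_next (enum_uniq X)).
    by move=> x y Xx _; rewrite /= permE /f Xx.
  by apply/allP=> x; rewrite mem_enum.
have enum_x0 : x0 \in enum X by rewrite mem_enum.
apply/setP => y; rewrite -[RHS]mem_enum -(fconnect_cycle fc enum_x0).
apply/porbitP/idP => [[i ->]|fxy]; first by rewrite permX fconnect_iter.
by exists (findex (perm f_inj) x0 y); rewrite permX iter_findex.
Qed.

(** Fixed points correspond to orbits of size 1. This is only an inequality, since [mu] may have
    parts equal to 1. *)
Lemma card_fixed_points n k mu s : sumn mu = k -> k <= n ->
    has_cycle_type (mu ++ nseq (n - k) 1) s ->
  n - k <= #|[set x : 'I_n | s x == x]|.
Proof.
move=> sum_mu le_kn type_s; apply: (@leq_trans #|[set Q in porbits s | #|Q| == 1]|).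
  have /seq.permP/(_ (pred1 1)) eq_count := type_s.
  have <- : count (pred1 1) (cycle_lengths s) = #|[set Q in porbits s | #|Q| == 1]|.
    rewrite /cycle_lengths /image_mem count_map -sum1_count big_enum_cond /=.
    by rewrite sum1dep_card.
  by rewrite eq_count count_cat count_nseq /= mul1n leq_addl.
apply: (leq_card_rel (r := fun (Q : {set 'I_n}) x => x \in Q)) => [Q|Q Q'].
  rewrite inE => /andP[/imsetP[x _ ->] /eqP card1]; exists x; last exact: porbit_id.
  have /card_le1_eqP le1 : #|porbit s x| <= 1 by rewrite card1.
  by rewrite inE; apply/eqP/le1; rewrite ?porbit_id // (mem_porbit s 1).
rewrite !inE => /andP[/imsetP[y _ ->] _] /andP[/imsetP[z _ ->] _] x.
by rewrite -!eq_porbit_mem => /eqP <- /eqP <-.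
Qed.

Lemma specht_char n la : specht_character n la \is a character.
Proof. exact: cfRepr_char. Qed.

Lemma dvdC_char_value n k mu la d : is_partition k mu -> k + d <= n -> 0 < d ->
    (forall p v s x, prime p -> v < logn p d ->
       #|porbit s x| = p ^ (trunc_log p (n - k) - v) ->
       specht_character n la s = 0%R) ->
  (d %| char_value n la mu)%C.
Proof.
move=> mu_k le_n d_gt0 vanish; have le_kn : k <= n by lia.
have := cycle_permP mu_k le_kn; rewrite /char_value.
set g := cycle_perm n mu; set chi := specht_character n la => type_g.
have Nchi := specht_char n la; rewrite -/chi in Nchi.
have chiQ : chi g \in Crat by apply: char_Sym_Crat.
have chiZ : chi g \in Num.int by rewrite Cint_rat_Aint ?Aint_char.
rewrite dvdC_int //; apply/dvdn_partP => // p pi_p.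
have p_pr : prime p by move: pi_p; rewrite mem_primes => /andP[].
(* On rational values, divisibility in the algebraic integers is divisibility in the integers, so
   [dvdA_char_cycle] applies. *)
rewrite p_part -dvdC_int // -eqAmod0_rat ?rpred_nat // eqAmod0.
set e := logn p d; set N := trunc_log p (n - k).
have p_gt1 := prime_gt1 p_pr.
have le_d : d <= n - k by lia.
have leeN : e <= N.
  by apply: trunc_log_max => //; apply: leq_trans le_d; apply/dvdn_leq/pfactor_dvdnn.
have le_pN : p ^ N <= #|[set x : 'I_n | g x == x]|.
  apply: leq_trans (card_fixed_points _ le_kn type_g).
    by apply: trunc_logP => //; lia.
  by case/and3P: mu_k => _ _ /eqP.
(* The cycle [c] is built on [p ^ N] fixed points of [g]. *)
have /card_geqP[b [Ub szb fixb]] := le_pN.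
have [x0 bx0] : exists x, x \in b.
  case: b szb {Ub fixb} => [/esym/eqP|x b _]; first by rewrite expn_eq0; lia.
  by exists x; rewrite mem_head.
have Xx0 : x0 \in [set x in b] by rewrite inE.
have [c c_on Dc] := perm_single_cycle Xx0.
rewrite -Dc in c_on; apply: (dvdA_char_cycle c_on p_pr leeN) => //.
- by rewrite Dc cardsE (card_uniqP Ub).
- by apply/pfixerP => x; rewrite Dc inE => /fixb; rewrite inE => /eqP.
by move=> v s x lt_v; apply: vanish.
Qed.

(** Each bad partition is related to a constituent of its Specht character that does not vanish on
    some relevant cycle; [specht_constt_inj] makes this relation injective. Both [p] and [v] are at
    most [d], hence the index type. *)
Lemma char_value_bad n k mu d : is_partition k mu -> k + d <= n -> 0 < d ->
  #|[set la in partitions n | ~~ (d %| char_value n (parts la) mu)%C]|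
    <= \sum_(pv : 'I_d.+1 * 'I_d.+1 | prime pv.1 && (pv.2 < logn pv.1 d))
         n * #|partitions (n - pv.1 ^ (trunc_log pv.1 (n - k) - pv.2))|.
Proof.
move=> mu_k le_n d_gt0.
pose t (pv : 'I_d.+1 * 'I_d.+1) := pv.1 ^ (trunc_log pv.1 (n - k) - pv.2).
pose P (pv : 'I_d.+1 * 'I_d.+1) := prime pv.1 && (pv.2 < logn pv.1 d).
pose U := \bigcup_(pv | P pv) nonvanishing_cycle 'I_n (t pv).
apply: (@leq_trans #|U|); last first.
  rewrite /U; elim/big_rec2: _ => [|pv m A _ leAm]; first by rewrite cards0.
  apply: leq_trans (leq_card_setU _ _) (leq_add _ leAm).
  by apply: leq_trans (card_nonvanishing_cycle _ _) _; rewrite card_ord.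
apply: (leq_card_rel (r := fun (la : n.-bseq 'I_n.+1) i =>
   '[specht_character n (parts la), 'chi_i]%R != 0%R)); last first.
  move=> la nu; rewrite !inE => /andP[la_n _] /andP[nu_n _] i nz_la nz_nu.
  exact/parts_inj/(specht_constt_inj la_n nu_n nz_la nz_nu).
move=> la; rewrite inE => /andP[_ ndvd]; apply/exists_inP.
apply: contraR ndvd => /exists_inPn noU.
apply: (dvdC_char_value mu_k le_n d_gt0) => p v s x p_pr lt_v card_s.
rewrite [specht_character n (parts la)]cfun_sum_cfdot sum_cfunE.
apply: big1 => i _; rewrite cfunE.
have [->|nz] := eqVneq '[specht_character n (parts la), 'chi_i]%R 0%R.
  by rewrite mul0r.
apply/eqP; rewrite mulf_eq0 (negPf nz) /=; apply: contraT => nz_s.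
have iU : i \in U; last by have := noU i iU; rewrite nz.
have le_p : p < d.+1.
  rewrite ltnS dvdn_leq //; move: lt_v; have [-> //|] := posnP (logn p d).
  by rewrite logn_gt0 mem_primes => /and3P[].
have le_v : v < d.+1.
  by apply: ltn_trans lt_v _; rewrite ltnS ltnW // ltn_logl.
apply/bigcupP; exists (Ordinal le_p, Ordinal le_v); first by rewrite /P p_pr.
rewrite inE; apply/existsP; exists s; rewrite nz_s andbT.
by apply/existsP; exists x; rewrite card_s.
Qed.

Lemma char_value_bad_linear k mu d : is_partition k mu -> 0 < d ->
  exists K n0, forall n, n0 <= n ->
  n * #|[set la in partitions n | ~~ (d %| char_value n (parts la) mu)%C]|
    <= K * #|partitions n|.
Proof.
(* The factor [d.+1 * d.+1] counts the pairs [(p, v)], and [6 * d] comes from [n <= 6 * d * t./2];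
   the threshold gives [k + d <= n] and [n <= 2 * (n - k)]. *)
move=> mu_k d_gt0; exists ((d.+1 * d.+1) * (4 * (6 * d) ^ 4)), (2 * k + 2 * d + 1).
move=> n le_n0.
have le_n : k + d <= n by lia.
apply: leq_trans (leq_mul (leqnn n) (char_value_bad mu_k le_n d_gt0)) _.
rewrite big_distrr /=.
apply: (@leq_trans (\sum_(pv : 'I_d.+1 * 'I_d.+1)
                      4 * (6 * d) ^ 4 * #|partitions n|)); last first.
  by rewrite sum_nat_const card_prod !card_ord -!mulnA.
rewrite big_mkcond /=; apply: leq_sum => -[p v] _ /=; case: ifP => // /andP[p_pr lt_v].
set N := trunc_log p (n - k); set t := p ^ (N - v).
have p_gt1 := prime_gt1 p_pr.
have le_pd : p ^ logn p d <= d by apply/dvdn_leq/pfactor_dvdnn.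
have leeN : logn p d <= N.
  by apply: trunc_log_max => //; apply: leq_trans le_pd _; lia.
have le_tn : t <= n.
  apply: (@leq_trans (p ^ N)); first by rewrite leq_exp2l // leq_subr.
  by apply: leq_trans (trunc_logP p_gt1 _) _; lia.
have t_ge2 : 2 <= t.
  have lt_vN : 0 < N - v by rewrite subn_gt0 (leq_trans lt_v).
  apply: (leq_trans p_gt1); rewrite -[X in X <= _]expn1.
  exact: leq_pexp2l (ltnW p_gt1) lt_vN.
(* Since [v] is below [logn p d], the exponent [N - v + logn p d] is at least [N + 1]. *)
have lt_n : n - k < t * d.
  apply: leq_trans (trunc_log_ltn (n - k) p_gt1) _.
  apply: leq_trans (leq_mul (leqnn t) le_pd).
  by rewrite -expnD leq_exp2l // -/N; lia.
have G := partitions_growth2 le_tn; set m := t./2 in G.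
have le_tm : t <= 3 * m by rewrite /m; have := odd_double_half t; case: (odd t); lia.
have le_nm : n <= 6 * d * m by nia.
set P1 := #|_| in G *; set P0 := #|partitions n| in G *.
have n_gt0 : 0 < n by lia.
have le4 : n ^ 4 <= (6 * d) ^ 4 * m ^ 4 by rewrite -expnMn leq_exp2r.
(* Multiplying by [n ^ 2] produces [n ^ 4], to be traded for [m ^ 4]; [G] then returns the factor
   [n ^ 2]. *)
rewrite -(leq_pmul2l (_ : 0 < n ^ 2)) ?expn_gt0 ?n_gt0 //.
have -> : n ^ 2 * (n * (n * P1)) = n ^ 4 * P1 by rewrite !expnS expn0; ring.
apply: leq_trans (leq_mul le4 (leqnn P1)) _.
rewrite -mulnA; apply: leq_trans (leq_mul (leqnn _) G) _.
by apply/eq_leq; ring.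
Qed.

Lemma card_setID_cond (T : finType) (A : {set T}) (P : pred T) :
  #|[set x in A | P x]| + #|[set x in A | ~~ P x]| = #|A|.
Proof.
rewrite -(cardsID [set x | P x] A); congr (_ + _); apply: eq_card => x.
  by rewrite !inE.
by rewrite !inE andbC.
Qed.

Lemma char_value_good k mu d : is_partition k mu -> 0 < d ->
  exists K n0, forall n, n0 <= n ->
  n.+1 * #|partitions n|
    <= n.+1 * #|[set la in partitions n | (d %| char_value n (parts la) mu)%C]|
       + K * #|partitions n|.
Proof.
move=> mu_k d_gt0; have [K [n0 bad_le]] := char_value_bad_linear mu_k d_gt0.
(* The extra unit in [K.+1] pays for replacing [n] by [n.+1], as bad partitions are at most all
   partitions. *)
exists K.+1, n0 => n /bad_le {bad_le}.
have := card_setID_cond (partitions n)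
  (fun la => (d %| char_value n (parts la) mu)%C).
set good := #|_|; set bad := #|_|; set p := #|_|; nia.
Qed.

End SpechtDivisibility.

From mathcomp Require Import all_classical all_reals all_analysis.
Import numFieldNormedType.Exports.

(** * Passage to the limit *)

Section RatioLimit.

Import Order.TTheory GRing.Theory Num.Theory.
Local Open Scope ring_scope.
Local Open Scope classical_set_scope.

(** The ratio is squeezed between [1 - K / n.+1] and 1; the form with [n.+1] matches the harmonic
    sequence. *)
Lemma cvg_ratio1 (R : realType) (a b : nat -> nat) (K n0 : nat) :
    (forall n, (0 < b n)%N) -> (forall n, (a n <= b n)%N) ->
    (forall n, (n0 <= n)%N -> (n.+1 * b n <= n.+1 * a n + K * b n)%N) ->
  (fun n => (a n)%:R / (b n)%:R : R) @ \oo --> (1 : R).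
Proof.
move=> b_gt0 le_ab le_b.
have cvg_low : (fun n => 1 - K%:R * n.+1%:R^-1 : R) @ \oo --> (1 : R).
  rewrite -[X in _ --> X](subr0 1); apply: cvgB; first exact: cvg_cst.
  rewrite -(mulr0 (K%:R : R)); apply: cvgM; [exact: cvg_cst | exact: cvg_harmonic].
apply: squeeze_cvgr cvg_low (cvg_cst (1 : R)).
exists n0 => // n /= le_n0n; have bR_gt0 : 0 < (b n)%:R :> R by rewrite ltr0n.
apply/andP; split; last by rewrite ler_pdivrMr // mul1r ler_nat.
have nR_gt0 : 0 < n.+1%:R :> R by rewrite ltr0n.
rewrite ler_pdivlMr // mulrBl mul1r lerBlDr -(ler_pM2l nR_gt0).
rewrite mulrDr !mulrA (mulrC _ K%:R) mulfK ?gt_eqF // -!natrM -natrD ler_nat.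
exact: le_b.
Qed.

End RatioLimit.

Theorem mainTheorem1 (R : realType) (k d : nat) (mu : seq nat)
    (hk : (0 < k)%N) (hd : (0 < d)%N) (hmu : is_partition k mu) :
  ((fun n : nat =>
      (#|[set la in partitions n | (d %| char_value n (parts la) mu)%C]|%:R
       / #|partitions n|%:R)%R : R) @ \oo --> (1%R : R))%classic.
Proof.
(* The bound is claimed only from [n0] on, so the default value of [cycle_perm] for [n] below [k]
   does not affect the limit. *)
have [K [n0 good_ge]] := char_value_good hmu hd.
apply: cvg_ratio1 good_ge => n; first exact: card_partitions_gt0.
by apply/subset_leq_card/fintype.subsetP=> la; rewrite inE => /andP[].
Qed.
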